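(* Let $(E_n)_{n\in\mathbb{N}}$ be a betting sequence with drift certificate $(c_n)$, and let $C_t\in\mathbb{R}$ ($t\in\mathbb{N}$) be constants with $\sum_{n\le t}c_n\ge C_t$ $\mathbb{P}_1$-a.s., $C_0:=0$. Assume there is a constant $\bar r\in(0,\infty)$ with $$L_n\le c_n+\bar r\qquad\mathbb{P}_1\text{-a.s., for every }n\in\mathbb{N}.$$ Put $$\widehat V_t:=\sum_{n\le t}(c_n-L_n)^2,\qquad\psi_{\mathrm{E}}(\lambda):=-\log(1-\lambda)-\lambda .$$ Fix constants $\lambda\in(0,1)$ and $\delta\in(0,1)$. Then, with $\mathbb{P}_1$-probability at least $1-\delta$, simultaneously for all $t\in\mathbb{N}_0$, $$\log W_t>C_t-\frac{\bar r}{\lambda}\log\frac1\delta-\frac{\psi_{\mathrm{E}}(\lambda)}{\lambda\,\bar r}\widehat V_t\ \ge\ C_t-\frac{\bar r}{\lambda}\log\frac1\delta-\frac{\lambda\,\widehat V_t}{2(1-\lambda)\,\bar r}.$$ Consequently, for every $\alpha\in(0,1)$, $\ \mathbb{P}_1(\tau_\alpha\le\widehat T)\ge1-\delta$, where $$\widehat T:=\inf\Big\{t\in\mathbb{N}:\ \frac{\lambda(C_t-\ell)}{\bar r}\ge\log\frac1\delta+\frac{\psi_{\mathrm{E}}(\lambda)}{\bar r^2}\widehat V_t\Big\},$$ and $\widehat T$ is a stopping time with respect to $(\mathcal{F}_t)$.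
   Context: Conventions: $\log$ is natural, $\log0=-\infty$; $\inf\emptyset=+\infty$. Setting: $(\Omega,\mathcal{F})$ is a measurable space with a filtration $(\mathcal{F}_t)_{t\in\mathbb{N}_0}$, $\mathcal{F}_0=\{\emptyset,\Omega\}$, and $\mathbb{P}_0,\mathbb{P}_1$ are probability measures with $\mathbb{P}_1|_{\mathcal{F}_t}\ll\mathbb{P}_0|_{\mathcal{F}_t}$ for all $t$. A betting sequence is a family of $\mathcal{F}_n$-measurable maps $E_n:\Omega\to[0,\infty]$ with $\mathbb{E}_{\mathbb{P}_0}[E_n\mid\mathcal{F}_{n-1}]\le1$ $\mathbb{P}_0$-a.s. Wealth: $W_0=1$, $W_t=\prod_{n\le t}E_n$; $L_n:=\log E_n$. For $\alpha\in(0,1)$: $\ell:=\log\frac1\alpha$, $\tau_\alpha:=\inf\{t\in\mathbb{N}:W_t>\frac1\alpha\}$. Drift certificate: real random variables $c_n$, $\mathcal{F}_{n-1}$-measurable, with $\mathbb{E}_{\mathbb{P}_1}[L_n\mid\mathcal{F}_{n-1}]\ge c_n$ $\mathbb{P}_1$-a.s. (conditional expectation in the extended sense, required to be well defined). *)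

(* Defs.v *)
From HB Require Import structures.
From mathcomp Require Import all_boot all_order all_algebra.
From mathcomp Require Import all_classical all_reals all_analysis.
From mathcomp Require Import measurable_realfun.
Import Order.TTheory GRing.Theory Num.Theory.
Import numFieldNormedType.Exports.

Set Implicit Arguments.
Unset Strict Implicit.
Unset Printing Implicit Defensive.

Local Open Scope classical_set_scope.
Local Open Scope ring_scope.
Local Open Scope ereal_scope.

Definition filtration d (T : measurableType d) (F : nat -> set (set T)) : Prop :=
  [/\ forall n, sigma_algebra setT (F n),
      forall n, F n `<=` measurable &
      forall m n, (m <= n)%N -> F m `<=` F n].

(* Measurability with respect to a sub-sigma-algebra G of the ambient one:
   when G is a sigma-algebra, the measurable sets of g_sigma_algebraType G are
   exactly the elements of G (measurable_g_measurableTypeE). *)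
Definition measurable_wrt d (T : measurableType d) (G : set (set T))
    d' (U : measurableType d') (f : T -> U) : Prop :=
  measurable_fun setT (f : g_sigma_algebraType G -> U).

Definition dominated_on d (T : measurableType d) (R : realType)
    (G : set (set T)) (P1 P0 : probability T R) : Prop :=
  forall A, G A -> P0 A = 0 -> P1 A = 0.

(* Y is a version of the conditional expectation of the [0, +oo]-valued X.
   Versions exist by Radon-Nikodym and are P-a.s. unique, so a P-a.s. property
   of the conditional expectation is stated below as "some version has it". *)
Definition condexp_ge0 d (T : measurableType d) (R : realType)
    (P : probability T R) (G : set (set T)) (X Y : T -> \bar R) : Prop :=
  [/\ forall x, 0 <= Y x,
      measurable_wrt G Y &
      forall A, G A -> \int[P]_(x in A) Y x = \int[P]_(x in A) X x].

(* Extended sense: E[X | G] = E[X^+ | G] - E[X^- | G], well defined when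
   P-a.s. the two terms are not both infinite; X need not be integrable. *)
Definition condexp d (T : measurableType d) (R : realType)
    (P : probability T R) (G : set (set T)) (X Y : T -> \bar R) : Prop :=
  measurable_wrt G Y /\
  exists Yp Yn : T -> \bar R,
    [/\ condexp_ge0 P G X^\+ Yp,
        condexp_ge0 P G X^\- Yn,
        {ae P, forall x, Yp x < +oo \/ Yn x < +oo} &
        {ae P, forall x, Y x = Yp x - Yn x}].

(* Processes indexed by {1, 2, ...} are functions on nat whose value at 0 is
   irrelevant; the step n >= 1 is written n.+1, and its past is F n. *)
Definition betting_sequence d (T : measurableType d) (R : realType)
    (P0 : probability T R) (F : nat -> set (set T))
    (E : nat -> T -> \bar R) : Prop :=
  forall n,
    [/\ forall x, 0 <= E n.+1 x,
        measurable_wrt (F n.+1) (E n.+1) &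
        exists2 Y, condexp_ge0 P0 (F n) (E n.+1) Y &
                   {ae P0, forall x, Y x <= 1}].

(* mule has 0 * +oo = 0; for a betting sequence E n = +oo has P0-probability 0. *)
Definition wealth (T : Type) (R : realType) (E : nat -> T -> \bar R)
    (t : nat) (x : T) : \bar R :=
  \prod_(1 <= n < t.+1) E n x.

(* lne is the extended logarithm, with lne 0 = -oo and lne +oo = +oo. *)
Definition log_incr (T : Type) (R : realType) (E : nat -> T -> \bar R)
    (n : nat) (x : T) : \bar R :=
  lne (E n x).

Definition drift_certificate d (T : measurableType d) (R : realType)
    (P1 : probability T R) (F : nat -> set (set T))
    (E : nat -> T -> \bar R) (c : nat -> T -> R) : Prop :=
  forall n,
    measurable_wrt (F n) (c n.+1) /\
    exists2 Y, condexp P1 (F n) (log_incr E n.+1) Y &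
               {ae P1, forall x, (c n.+1 x)%:E <= Y x}.

(* Extended-real valued because log_incr E n may be infinite, on a P1-null set
   under a drift certificate with log-increments bounded above. *)
Definition Vhat (T : Type) (R : realType) (E : nat -> T -> \bar R)
    (c : nat -> T -> R) (t : nat) (x : T) : \bar R :=
  \sum_(1 <= n < t.+1) ((c n x)%:E - log_incr E n x) ^+ 2.

Definition psiE (R : realType) (lambda : R) : R :=
  (- ln (1 - lambda) - lambda)%R.

(* First t >= 1 such that Q t x; it is +oo if there is none (ereal_inf0). *)
Definition first_time (T : Type) (R : realType) (Q : nat -> T -> Prop)
    (x : T) : \bar R :=
  ereal_inf [set t%:R%:E | t in [set t : nat | (0 < t)%N /\ Q t x]].

Definition tau (T : Type) (R : realType) (E : nat -> T -> \bar R) (alpha : R) :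
    T -> \bar R :=
  first_time R (fun t x => wealth E t x > (alpha^-1)%:E).

Definition That (T : Type) (R : realType) (E : nat -> T -> \bar R)
    (c : nat -> T -> R) (C : nat -> R) (rbar lambda delta alpha : R) :
    T -> \bar R :=
  first_time R (fun t x =>
    (lambda * (C t - ln alpha^-1) / rbar)%:E >=
    (ln delta^-1)%:E + (psiE lambda / rbar ^+ 2)%:E * Vhat E c t x).

Definition stopping_time (T : Type) (R : realType) (F : nat -> set (set T))
    (S : T -> \bar R) : Prop :=
  forall t : nat, F t [set x | S x <= t%:R%:E].

(* P A is meaningful only for measurable A, hence the first conjunct. *)
Definition prob_at_least d (T : measurableType d) (R : realType)
    (P : probability T R) (p : R) (A : set T) : Prop :=
  measurable A /\ p%:E <= P A.

(* Main.v *)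
(* Put xi_n := (c_n - L_n) / rbar. The increment bound says xi_n >= -1 and the
   drift certificate says E[xi_n | F_(n-1)] <= 0, so Fan's inequality
   exp(lambda xi - psiE(lambda) xi^2) <= 1 + lambda xi makes
   M_t = exp(sum_(n <= t) (lambda xi_n - psiE(lambda) xi_n^2)) a nonnegative
   supermartingale with M_0 = 1. Ville's inequality bounds by delta the
   probability that M ever reaches 1/delta, and off that event
   log M_t < log(1/delta) is the asserted lower bound on log W_t. *)
Require Import Defs.
From HB Require Import structures.
From mathcomp Require Import all_boot all_order all_algebra.
From mathcomp Require Import all_classical all_reals all_analysis.
From mathcomp Require Import measurable_realfun.
From mathcomp Require Import ring lra.
Import Order.TTheory GRing.Theory Num.Theory.
Import numFieldNormedType.Exports.
Import HBNNSimple.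

Local Open Scope classical_set_scope.
Local Open Scope ring_scope.
Local Open Scope ereal_scope.

Set Implicit Arguments.
Unset Strict Implicit.

(** The $L_n$ need not be integrable under [P1], and their conditional expectation exists only as a
    difference of two $[0,+\infty]$-valued versions, so $1+\lambda\xi_n$ cannot be integrated by
    linearity. Fan's inequality is therefore used with every negative part moved to the other side,
    and is integrated over events of the past on which whatever has to be cancelled is finite.
    Likewise no conditional expectation of $M$ is ever formed: the supermartingale property is a
    comparison of integrals over sets of [F n], which is all that the argument for Ville's
    inequality uses. The coefficient $\psi_E(\lambda)$ is the smallest possible one: Fan's
    inequality is an equality at $\xi=-1$, the lowest value that the increment bound permits. *)

Section psiE.
Local Open Scope ring_scope.
Variable R : realType.
Lemma is_derive_ge0_le (f df : R -> R) (a b : R) : a <= b ->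
  (forall x, x \in `[a, b] -> is_derive x 1 f (df x)) ->
  (forall x, x \in `[a, b] -> 0 <= df x) -> f a <= f b.
Proof.
move=> ab fdf df0.
have fc : {within `[a, b]%classic, continuous f}.
  by apply: derivable_within_continuous => x xab; have [] := fdf x xab.
have fd x : x \in `]a, b[ -> is_derive x 1 f (df x).
  by move=> /subset_itv_oo_cc; exact: fdf.
have [c cab fE] := @MVT_segment _ f df a b ab fd fc.
by rewrite -subr_ge0 fE mulr_ge0 ?df0 // subr_ge0.
Qed.

Lemma is_derive_psiE (x : R) : x < 1 -> is_derive x 1 (@psiE R) (x / (1 - x)).
Proof.
move=> x1; have x1' : 0 < 1 - x by rewrite subr_gt0.
have h : is_derive x 1 (fun y : R => 1 - y) (0 - 1).
  exact: (is_deriveB (is_derive_cst (1:R) x 1) (is_derive_id x (1:R))).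
have h2 : is_derive x 1 (fun y : R => ln (1 - y)) ((1 - x)^-1 * (0 - 1)).
  exact: (@is_derive1_comp _ (@ln R) (fun y : R => 1 - y) x _ _ (is_derive1_ln x1')).
apply: (is_derive_eq (is_deriveB (is_deriveN h2) (is_derive_id x (1:R)))).
by field; lra.
Qed.

Lemma psiE0 : psiE (0 : R) = 0.
Proof. by rewrite /psiE !subr0 ln1 oppr0. Qed.

(** Both sides vanish at $l=0$, and their difference has derivative $u^2l^2(1-u)/((1-l)(1-ul))\ge0$
    in $l$. Arbitrarily negative [u] is allowed, so that Fan's inequality needs no upper bound on
    its variable. *)
Lemma psiE_mul_le (l u : R) : 0 <= l < 1 -> u <= 1 ->
  psiE (u * l) <= u ^+ 2 * psiE l.
Proof.
move=> /andP[l0 l1] u1.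
have us x : x \in `[0, l] -> 0 <= x < 1 /\ u * x <= x.
  rewrite in_itv/= => /andP[x0 xl]; split; first by rewrite x0 (le_lt_trans xl).
  by rewrite ler_piMl.
suff : u ^+ 2 * psiE 0 - psiE (u * 0) <= u ^+ 2 * psiE l - psiE (u * l).
  by rewrite mulr0 psiE0 mulr0 subrr subr_ge0.
apply: (@is_derive_ge0_le (fun s => u ^+ 2 * psiE s - psiE (u * s))
  (fun s => u ^+ 2 * (s / (1 - s)) - (u * s / (1 - u * s)) * u) 0 l l0).
- move=> x /us[/andP[x0 x1] uxx].
  have h : is_derive x 1 (fun y : R => u * y) (u * 1).
    exact: (is_deriveZ u (is_derive_id x (1:R))).
  rewrite mulr1 in h.
  have hu : is_derive (u * x) 1 (@psiE R) (u * x / (1 - u * x)).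
    by apply: is_derive_psiE; rewrite (le_lt_trans uxx).
  exact: (is_deriveB (is_deriveZ (u ^+ 2) (is_derive_psiE x1))
    (@is_derive1_comp _ (@psiE R) (fun y : R => u * y) x _ _ hu h)).
- move=> x /us[/andP[x0 x1] uxx].
  have ux1 := le_lt_trans uxx x1.
  suff -> : u ^+ 2 * (x / (1 - x)) - u * x / (1 - u * x) * u =
     u ^+ 2 * (x * (x - u * x)) / ((1 - x) * (1 - u * x)).
    have w1 := ltW x1; have w2 := ltW ux1.
    apply: divr_ge0.
      by rewrite mulr_ge0 ?sqr_ge0 ?mulr_ge0 ?subr_ge0.
    by apply: mulr_ge0; rewrite subr_ge0.
  have hx : 1 - x != 0 by lra.
  have hux : 1 - u * x != 0 by lra.
  by field; rewrite hx hux.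
Qed.

Lemma psiE_le (l : R) : 0 <= l < 1 -> psiE l <= l ^+ 2 / (2 * (1 - l)).
Proof.
move=> /andP[l0 l1].
(* Since $s^2/(1-s)=1/(1-s)-s-1$, this is the difference of the two sides up to the constant $1/2$;
   its derivative is $\frac12(s/(1-s))^2$. *)
pose f (s : R) := (2^-1 * ((1 - s)^-1 - s)) - psiE s.
suff : f 0 <= f l.
  rewrite /f psiE0 -(subr_ge0 (psiE l)) -[leLHS]addr0 -lerBrDl.
  by move/le_trans; apply; rewrite le_eqVlt; apply/orP; left; apply/eqP; field; lra.
apply: (@is_derive_ge0_le f (fun s => 2^-1 * (- (1 - s) ^- 2 * (0 - 1) - 1) - s / (1 - s)) 0 l l0).
- move=> x; rewrite in_itv/= => /andP[x0 xl].
  have x1 : 0 < 1 - x by lra.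
  have h : is_derive x 1 (fun y : R => 1 - y) (0 - 1).
    exact: (is_deriveB (is_derive_cst (1:R) x 1) (is_derive_id x (1:R))).
  have hV := @is_deriveV R (fun y : R => 1 - y) x _ 1 (lt0r_neq0 x1) h.
  have hp : is_derive x 1 (@psiE R) (x / (1 - x)) by apply: is_derive_psiE; lra.
  exact: (is_deriveB (is_deriveZ 2^-1 (is_deriveB hV (is_derive_id x (1:R)))) hp).
- move=> x; rewrite in_itv/= => /andP[x0 xl].
  have x1 : 0 < 1 - x by lra.
  suff -> : 2^-1 * (- (1 - x) ^- 2 * (0 - 1) - 1) - x / (1 - x) =
     2^-1 * (x / (1 - x)) ^+ 2 by rewrite mulr_ge0 ?sqr_ge0.
  by field; lra.
Qed.

(** This is [psiE_mul_le] at $u=-y$, because $\psi_E(-ly)=ly-\log(1+ly)$. *)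
Lemma expR_psiE_le (l y : R) : 0 <= l < 1 -> -1 <= y ->
  expR (l * y - psiE l * y ^+ 2) <= 1 + l * y.
Proof.
move=> /[dup] hl /andP[l0 l1] y1.
have ly : 0 < 1 + l * y.
  rewrite (@lt_le_trans _ _ (1 - l)) ?subr_gt0// lerD2l -mulrN1.
  by rewrite ler_wpM2l.
rewrite -[leRHS]lnK ?posrE// ler_expR.
have /psiE_mul_le/(_ (_ : -y <= 1)) := hl.
rewrite /psiE sqrrN => /(_ ltac:(lra)).
by rewrite mulNr opprK (mulrC y) => h; lra.
Qed.
End psiE.

(** * Sub-sigma-algebras and pulling out a measurable factor *)

Section sub_sigma.
Context d (T : measurableType d) (R : realType).
Implicit Types (P : probability T R) (G H : set (set T)).

Lemma measurable_wrtS G H d' (U : measurableType d') (f : T -> U) :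
  G `<=` H -> measurable_wrt G f -> measurable_wrt H f.
Proof.
move=> GH mf mT B mB; apply: (sub_sigma_algebra2 GH).
exact: (mf measurableT B mB).
Qed.

Lemma measurable_wrtW G d' (U : measurableType d') (f : T -> U) :
  G `<=` measurable -> measurable_wrt G f -> measurable_fun setT f.
Proof.
move=> Gm mf mT B mB.
exact: (smallest_sub (sigma_algebra_measurable T) Gm (mf measurableT B mB)).
Qed.

Lemma g_measurable G A : sigma_algebra setT G ->
  measurable (A : set (g_sigma_algebraType G)) -> G A.
Proof. by move=> sG; rewrite measurable_g_measurableTypeE. Qed.

(** The hypothesis on integrals over [B] encodes $E[U\mid G]\le1$. On a level set $\{g=r\}$, which
    lies in [G], the claim is [r] times that hypothesis for $A\cap\{g=r\}$; the finitely many levels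
    are then summed. *)
Lemma integral_mul_nnsfun_le P G (U : T -> R)
    (g : {nnsfun (g_sigma_algebraType G) >-> R}) A :
  sigma_algebra setT G -> G `<=` measurable ->
  measurable_fun setT U -> (forall x, (0 <= U x)%R) ->
  (forall B, G B -> \int[P]_(x in B) (U x)%:E <= P B) -> G A ->
  \int[P]_(x in A) ((g x)%:E * (U x)%:E) <= \int[P]_(x in A) (g x)%:E.
Proof.
move=> sG Gm mU U0 UP GA.
pose t (r : R) (x : T) : \bar R := (r * \1_(g @^-1` [set r]) x)%:E.
have Gg r : G (g @^-1` [set r]).
  by apply: g_measurable => //; exact: measurable_funPTI.
have mg r : measurable (g @^-1` [set r] : set T) := Gm _ (Gg r).
have mt r : measurable_fun A (t r).
  by apply/measurable_EFinP/measurable_funM => //; exact: measurable_indic.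
have t0 r x : 0 <= t r x.
  rewrite /t EFinM; exact: (nnfun_muleindic_ge0 g).
have mA := Gm _ GA.
have mUA : measurable_fun A (EFin \o U).
  by apply/measurable_EFinP; exact: measurable_funTS.
have gE x : (g x)%:E = \sum_(r \in range g) t r x.
  by rewrite fsumEFin// -fimfunE.
rewrite (eq_integral (fun x => \sum_(r \in range g) (t r x * (U x)%:E))); last first.
  by move=> x _; rewrite gE ge0_mule_fsuml.
rewrite [leRHS](eq_integral (fun x => \sum_(r \in range g) t r x)); last first.
  by move=> x _; rewrite gE.
rewrite !ge0_integral_fsum//; first last.
- by move=> r x _; apply: mule_ge0; rewrite ?t0// lee_fin.
- by move=> r; exact: emeasurable_funM.
apply: lee_fsum => // r [y _ gy].
have r0 : (0 <= r)%R by rewrite -gy.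
pose B : set T := g @^-1` [set r].
have GB : G B by exact: Gg.
have mB : measurable B := mg r.
rewrite (eq_integral (fun x : T => r%:E * ((EFin \o U) \_ B) x)); last first.
  move=> x _; rewrite /t patchE indicE EFinM -muleA; congr (_ * _).
  by case: ifPn; rewrite ?mul1e ?mul0e.
rewrite ge0_integralZl//; first last.
- by move=> x _; rewrite patchE; case: ifPn => // _; rewrite lee_fin.
- apply: measurable_funTS; apply/(measurable_restrictT _ _).1 => //.
  by apply/measurable_EFinP; exact: measurable_funTS.
rewrite -integral_mkcondr.
rewrite [leRHS](eq_integral (fun x : T => r%:E * (\1_B x)%:E))//.
rewrite ge0_integralZl//; last exact/measurable_EFinP/measurable_indic.
rewrite lee_wpmul2l// integral_indic// setIC; apply: UP.
have := @measurableI _ (g_sigma_algebraType G) B A.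
by rewrite measurable_g_measurableTypeE//; apply.
Qed.

(** Monotone convergence along simple functions built over [G] itself rather than over the ambient
    sigma-algebra, so that their level sets are in [G]. Both integrals may be infinite. *)
Lemma integral_mul_le P G (Z : T -> \bar R) (U : T -> R) A :
  sigma_algebra setT G -> G `<=` measurable ->
  measurable_wrt G Z -> (forall x, 0 <= Z x) ->
  measurable_fun setT U -> (forall x, (0 <= U x)%R) ->
  (forall B, G B -> \int[P]_(x in B) (U x)%:E <= P B) -> G A ->
  \int[P]_(x in A) (Z x * (U x)%:E) <= \int[P]_(x in A) Z x.
Proof.
move=> sG Gm mZ Z0 mU U0 UP GA; have mA := Gm _ GA.
have mGA : measurable (A : set (g_sigma_algebraType G)).
  by rewrite measurable_g_measurableTypeE.
have mZA : measurable_fun (A : set (g_sigma_algebraType G)) Z.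
  exact: measurable_funTS.
pose f := nnsfun_approx mGA mZA.
have mf n : measurable_fun setT (f n : T -> R).
  apply: (measurable_wrtW Gm).
  have mfn : measurable_fun (setT : set (g_sigma_algebraType G)) (f n) by [].
  exact: mfn.
have mfA n : measurable_fun A (fun x : T => (f n x)%:E).
  by apply/measurable_EFinP; exact: measurable_funTS.
have mUA : measurable_fun A (EFin \o U).
  by apply/measurable_EFinP; exact: measurable_funTS.
have mfU n : measurable_fun A (fun x : T => (f n x)%:E * (U x)%:E).
  exact: emeasurable_funM.
have f0 n (x : T) : A x -> 0 <= (f n x)%:E by rewrite lee_fin.
have fU0 n (x : T) : A x -> 0 <= (f n x)%:E * (U x)%:E.
  by move=> _; rewrite mule_ge0 ?lee_fin.
have fZ (x : T) : A x -> (f n x)%:E @[n --> \oo] --> Z x.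
  by move=> Ax; apply: (cvg_nnsfun_approx mGA mZA).
have ndf (x : T) : {homo (fun n => (f n x)%:E) : m n / (m <= n)%N >-> m <= n}.
  by move=> m n mn; rewrite lee_fin; have /lefP := nd_nnsfun_approx mGA mZA mn; exact.
have ndfU (x : T) : {homo (fun n => (f n x)%:E * (U x)%:E) : m n / (m <= n)%N >-> m <= n}.
  by move=> m n mn; rewrite lee_wpmul2r ?lee_fin//; exact: ndf.
rewrite (eq_integral (fun x : T => limn (fun n => (f n x)%:E * (U x)%:E))); last first.
  move=> x /set_mem Ax; apply/esym/cvg_lim => //.
  by apply: cvgeZr => //; exact: fZ.
rewrite [leRHS](eq_integral (fun x : T => limn (fun n => (f n x)%:E))); last first.
  by move=> x /set_mem Ax; apply/esym/cvg_lim => //; exact: fZ.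
rewrite !monotone_convergence//.
apply: lee_lim.
- apply: ereal_nondecreasing_is_cvgn => m n mn; apply: ge0_le_integral => //.
  + exact: fU0.
  + by move=> x _; exact: ndfU.
- apply: ereal_nondecreasing_is_cvgn => m n mn; apply: ge0_le_integral => //.
  + exact: f0.
  + by move=> x _; exact: ndf.
- by apply: nearW => n; exact: integral_mul_nnsfun_le.
Qed.

End sub_sigma.

(** * Extended conditional expectations under a drift bound, and Ville's inequality *)

Section drift_and_ville.
Context d (T : measurableType d) (R : realType).
Implicit Types (P : probability T R) (G : set (set T)).

Lemma le_measure_ae P (A B : set T) : measurable A -> measurable B ->
  {ae P, forall x, A x -> B x} -> P A <= P B.
Proof.
move=> mA mB [N [mN PN0 ABN]].
apply: (@le_trans _ _ (P (B `|` N))).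
  apply: le_measure; rewrite ?inE//; first exact: measurableU.
  move=> x Ax; have [Bx|nBx] := pselect (B x); first by left.
  by right; apply: ABN => /= /(_ Ax).
apply: (le_trans (measureU2 _ mB mN)); by rewrite [X in _ + X]PN0 adde0.
Qed.

(** The bound $c\le y_p-y_n$ with all terms moved to where they are nonnegative. An infinite [yn]
    would force [yp] to be finite, and the difference would be $-\infty<c$. *)
Lemma cond_drift_le (c : R) (yp yn : \bar R) : 0 <= yp -> 0 <= yn ->
  yp < +oo \/ yn < +oo -> c%:E <= yp - yn ->
  maxe c%:E 0 + yn <= yp + maxe (- c%:E) 0 /\ yn < +oo.
Proof.
case: yp => [yp||] //; case: yn => [yn||] // _ _ _.
  rewrite -EFinN -!EFin_max -!EFinD !lee_fin => h; split; last exact: ltry.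
  by rewrite /Num.max; case: (ltP c 0%R) => ?; case: (ltP (- c)%R 0%R) => ?; lra.
move=> _; split; last exact: ltry.
by rewrite addye ?leey// -EFinN -EFin_max.
Qed.

(** On the event $\{Y_n\le k\}$ of [G], $X^-$ has the same integral as [Yn], hence at most $k$, so
    it is almost surely finite there. The lower bound on [Y] makes [Yn] almost surely finite, so
    these events exhaust the space up to a null set. *)
Lemma condexp_gtNy (P : probability T R) G (X Y : T -> \bar R) (a : T -> R) :
  sigma_algebra setT G -> G `<=` measurable -> measurable_fun setT X ->
  condexp P G X Y -> {ae P, forall x, (a x)%:E <= Y x} ->
  {ae P, forall x, -oo < X x}.
Proof.
move=> sG Gm mX [mY [Yp [Yn [[Yp0 mYp YpE] [Yn0 mYn YnE] Ylt YE]]]] aY.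
have Yn_fin : {ae P, forall x, Yn x < +oo}.
  near=> x.
  have h1 : (a x)%:E <= Y x by near: x.
  have h2 : Yp x < +oo \/ Yn x < +oo by near: x.
  have h3 : Y x = Yp x - Yn x by near: x.
  rewrite h3 in h1.
  by have [] := cond_drift_le (Yp0 x) (Yn0 x) h2 h1.
have Xn_fin : {ae P, forall x, forall k : nat, Yn x <= k%:R%:E -> X^\- x \is a fin_num}.
  apply: ae_foralln => k.
  pose K := setT `&` [set x | Yn x <= k%:R%:E].
  have GK : G K.
    rewrite -(measurable_g_measurableTypeE sG).
    exact: (@emeasurable_fun_infty_c _ (g_sigma_algebraType G)).
  have mK := Gm _ GK.
  have iX : P.-integrable K X^\-.
    apply/integrableP; split.
      by apply: measurable_funTS; exact: measurable_funeneg.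
    rewrite (eq_integral X^\-); last by move=> x _; rewrite gee0_abs.
    rewrite -YnE//.
    apply: (@le_lt_trans _ _ (\int[P]_(x in K) cst k%:R%:E x)).
      apply: ge0_le_integral => //; last by move=> x [].
      by apply: measurable_funTS; exact: measurable_wrtW Gm mYn.
    rewrite integral_cst// lte_mul_pinfty ?lee_fin//.
    by rewrite (le_lt_trans (probability_le1 _ mK)) ?ltry.
  by apply: filterS (integrable_ae mK iX) => x h Ynx; apply: h.
near=> x.
have h1 : Yn x < +oo by near: x.
have h2 : forall k : nat, Yn x <= k%:R%:E -> X^\- x \is a fin_num by near: x.
have Ynfin : Yn x \is a fin_num by rewrite ge0_fin_numE.
have : X^\- x \is a fin_num.
  apply: (h2 (Num.bound (fine (Yn x)))).
  by rewrite -(fineK Ynfin) lee_fin ltW// archi_boundP// fine_ge0.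
by rewrite funenegE; case: (X x) => [r _|_|]; rewrite ?ltNyr ?ltNyy //= maxye.
Unshelve. all: by end_near. Qed.

(* Truncating on [c^+ + Yn <= k] makes the terms to be cancelled finite, so only
   integrals of nonnegative functions are ever added. *)
Lemma condexp_drift_le P G (X Y : T -> \bar R) (c U : T -> R) (a : R) A :
  sigma_algebra setT G -> G `<=` measurable -> (0 <= a)%R ->
  measurable_fun setT X -> condexp P G X Y -> measurable_wrt G c ->
  {ae P, forall x, (c x)%:E <= Y x} ->
  measurable_fun setT U -> (forall x, (0 <= U x)%R) ->
  {ae P, forall x, (U x)%:E + a%:E * (X^\+ x + (EFin \o c)^\- x) <=
                   1 + a%:E * ((EFin \o c)^\+ x + X^\- x)} ->
  G A -> \int[P]_(x in A) (U x)%:E <= P A.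
Proof.
move=> sG Gm a0 mX [mY [Yp [Yn [[Yp0 mYp YpE] [Yn0 mYn YnE] Ylt YE]]]] Gc cY
  mU U0 UX GA.
set cp := (EFin \o c)^\+; set cn := (EFin \o c)^\-.
have GcE : measurable_wrt G (EFin \o c).
  by apply: (measurableT_comp _ Gc); exact/measurable_EFinP.
have mcp : measurable_fun setT cp.
  by apply: measurable_funepos; exact: (measurable_wrtW Gm GcE).
have mcn : measurable_fun setT cn.
  by apply: measurable_funeneg; exact: (measurable_wrtW Gm GcE).
have cp0 x : 0 <= cp x by exact: funepos_ge0.
have cn0 x : 0 <= cn x by exact: funeneg_ge0.
have Xp0 x : 0 <= X^\+ x by exact: funepos_ge0.
have Xn0 x : 0 <= X^\- x by exact: funeneg_ge0.
have mXp : measurable_fun setT X^\+ by exact: measurable_funepos.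
have mXn : measurable_fun setT X^\- by exact: measurable_funeneg.
have mEU : measurable_fun setT (EFin \o U) by exact/measurable_EFinP.
have mYp' := measurable_wrtW Gm mYp.
have mYn' := measurable_wrtW Gm mYn.
have drift : {ae P, forall x, cp x + Yn x <= Yp x + cn x /\ Yn x < +oo}.
  near=> x.
  have h1 : (c x)%:E <= Y x by near: x.
  have h2 : Yp x < +oo \/ Yn x < +oo by near: x.
  have h3 : Y x = Yp x - Yn x by near: x.
  rewrite h3 in h1; rewrite /cp /cn funeposE funenegE /=; exact: cond_drift_le (Yp0 x) (Yn0 x) h2 h1.
pose K (k : nat) := A `&` [set x | cp x + Yn x <= k%:R%:E].
have GK k : G (K k).
  rewrite -(measurable_g_measurableTypeE sG).
  rewrite /K -[X in _ `&` X]setTI; apply: measurableI.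
    by rewrite measurable_g_measurableTypeE.
  apply: (@emeasurable_fun_infty_c _ (g_sigma_algebraType G)) => //.
  by apply: emeasurable_funD => //; exact: measurable_funepos.
have mK k : measurable (K k) := Gm _ (GK k).
have KU k : \int[P]_(x in K k) (U x)%:E <= P A.
  apply: (@le_trans _ _ (P (K k))); last first.
    by apply: le_measure; rewrite ?inE//; [exact: Gm|exact: subIsetl].
  have tS f : measurable_fun setT f -> measurable_fun (K k) (f : T -> \bar R).
    exact: measurable_funTS.
  have PK : P (K k) \is a fin_num by exact: fin_num_measure.
  (* The hypothesis [UX] is $U\le1+a(c-X)$ in sign-separated form. *)
  have : \int[P]_(x in K k) ((U x)%:E + a%:E * (X^\+ x + cn x)) <=
         \int[P]_(x in K k) (1 + a%:E * (cp x + X^\- x)).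
    apply: ae_ge0_le_integral => //.
    - by move=> x _; rewrite adde_ge0 ?mule_ge0 ?adde_ge0 ?lee_fin.
    - apply: tS; apply: emeasurable_funD => //.
      by apply: measurable_funeM; exact: emeasurable_funD.
    - by move=> x _; rewrite adde_ge0 ?mule_ge0 ?adde_ge0 ?lee_fin.
    - apply: tS; apply: emeasurable_funD => //.
      by apply: measurable_funeM; exact: emeasurable_funD.
    - by apply: filterS UX => x + _.
  have a0' : 0 <= a%:E by rewrite lee_fin.
  have mXc : measurable_fun setT (fun x => X^\+ x + cn x) by exact: emeasurable_funD.
  have mcX : measurable_fun setT (fun x => cp x + X^\- x) by exact: emeasurable_funD.
  rewrite !ge0_integralD//; try by [move=> x _; rewrite ?mule_ge0 ?adde_ge0 ?lee_fin
     | apply: tS => //; exact: measurable_funeM].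
  rewrite !ge0_integralZl//; try by [move=> x _; rewrite ?adde_ge0 | exact: tS].
  rewrite !ge0_integralD//; try exact: tS.
  rewrite -YpE// -YnE// integral_cst// mul1e.
  (* With [Yp], [Yn] now in place of $X^+$, $X^-$, [h] reads $\int U+ap\le P(K_k)+aq$. The drift
     gives $q\le p$ and the truncation gives $q\le k$, so the finite $aq$ cancels. *)
  set q := \int[P]_(x in K k) cp x + _; set p := _ + \int[P]_(x in K k) cn x => h.
  have qp : q <= p.
    rewrite /q /p -!ge0_integralD//; try exact: tS.
    apply: ae_ge0_le_integral => //; try by [move=> x _; rewrite adde_ge0 |
      apply: tS; exact: emeasurable_funD].
    by apply: filterS drift => x [].
  have qk : q <= k%:R%:E.
    rewrite /q -!ge0_integralD//; try exact: tS.
    apply: (@le_trans _ _ (\int[P]_(x in K k) cst k%:R%:E x)).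
      apply: ge0_le_integral => //; try by [move=> x _; rewrite adde_ge0 |
        apply: tS; exact: emeasurable_funD | move=> x []].
    rewrite integral_cst// -[leRHS]mule1 lee_wpmul2l ?lee_fin//.
    exact: probability_le1.
  have q0 : 0 <= q by rewrite adde_ge0// integral_ge0.
  have qfin : a%:E * q \is a fin_num.
    by rewrite fin_numM// ge0_fin_numE// (le_lt_trans qk) ?ltry.
  rewrite -(leeD2rE _ _ qfin) (le_trans _ h)// leeD2l// lee_wpmul2l//.
have mA := Gm _ GA.
have KA : \bigcup_k K k `<=` A by move=> x [k _ []].
have mUK : measurable (\bigcup_k K k) by exact: bigcupT_measurable.
have ndK : {homo K : n m / (n <= m)%N >-> (n <= m)%O}.
  move=> n m nm; apply/subsetPset => x [Ax qx]; split => //.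
  by rewrite /= (le_trans qx)// lee_fin ler_nat.
have KUlim := ge0_nondecreasing_set_cvg_integral ndK mK
  (fun k => measurable_funTS mEU) (fun k x _ => U0 x : 0 <= (U x)%:E) (mu := P).
have : \int[P]_(x in \bigcup_k K k) (U x)%:E <= P A.
  rewrite -(cvg_lim _ KUlim)//; apply: lime_le; first by apply/cvg_ex; eexists; exact: KUlim.
  by apply: nearW => k; exact: KU.
apply: le_trans.
have mN : measurable (A `\` \bigcup_k K k) by exact: measurableD.
(* As $c^+$ is finite, a point of [A] outside every [K k] has $Y_n=+\infty$, which the drift
   excludes almost surely. *)
have PN : P (A `\` \bigcup_k K k) = 0.
  apply/(negligibleP _ mN); apply: negligibleS drift => x [Ax nKx] /= [_ Ynx].
  apply: nKx; have cpx : cp x < +oo.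
    by rewrite /cp funeposE /= -EFin_max ltry.
  have s0 : 0 <= cp x + Yn x by rewrite adde_ge0.
  have sfin : cp x + Yn x \is a fin_num by rewrite ge0_fin_numE// lte_add_pinfty.
  exists (Num.bound (fine (cp x + Yn x))) => //; split => //=.
  by rewrite -(fineK sfin) lee_fin ltW// archi_boundP// fine_ge0.
rewrite (ge0_negligible_integral mN mA (measurable_funTS mEU)
  (fun x _ => U0 x : 0 <= (EFin \o U) x) PN).
rewrite setDD; apply: ge0_subset_integral => //.
- exact: measurableI.
- exact: measurable_funTS.
- by move=> x _; rewrite /= lee_fin.
Unshelve. all: by end_near. Qed.

(** With $D_t$ the event that [M] has reached [a] by time $t$, induction preserves
    $aP(D_t)+\int_{D_t^c}M_t\le1$. This replaces optional stopping, so no stopped process is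
    built. *)
Lemma ville P (F : nat -> set (set T)) (M : nat -> T -> R) (a : R) :
  filtration F -> (0 < a)%R ->
  (forall n, measurable_wrt (F n) (M n)) -> (forall n x, (0 <= M n x)%R) ->
  \int[P]_x (M 0%N x)%:E <= 1 ->
  (forall n A, F n A ->
     \int[P]_(x in A) (M n.+1 x)%:E <= \int[P]_(x in A) (M n x)%:E) ->
  P (\bigcup_t [set x | (a <= M t x)%R]) <= (a^-1)%:E.
Proof.
move=> [sF Fm Fmono] a0 mM M0 M1 MS.
pose B t := [set x | (a <= M t x)%R].
have FB t : F t (B t).
  rewrite -(measurable_g_measurableTypeE (sF t)) -[B t]setTI.
  have /measurable_EFinP mMt := mM t.
  exact: (@emeasurable_fun_c_infty _ (g_sigma_algebraType (F t)) _ _ _ measurableT mMt a%:E).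
have mB t : measurable (B t) := Fm _ _ (FB t).
pose D t := \big[setU/set0]_(s < t.+1) B s.
have FD t : F t (D t).
  rewrite -(measurable_g_measurableTypeE (sF t)).
  apply: (@bigsetU_measurable _ (g_sigma_algebraType (F t))) => s _.
  rewrite measurable_g_measurableTypeE//; apply: (Fmono s) => //.
  by rewrite -ltnS.
have mD t : measurable (D t) := Fm _ _ (FD t).
have mEM t : measurable_fun setT (EFin \o M t).
  by apply/measurable_EFinP; exact: (measurable_wrtW (Fm t)).
(* Markov's inequality on the part of [A] where $M_t\ge a$, keeping the integral over the rest. *)
have split_le t A : measurable A ->
    a%:E * P (A `&` B t) + \int[P]_(x in A `\` B t) (M t x)%:E <=
    \int[P]_(x in A) (M t x)%:E.
  move=> mA.
  have mAB : measurable (A `&` B t) by exact: measurableI.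
  have mADB : measurable (A `\` B t) by exact: measurableD.
  rewrite -[in leRHS](setUIDK A (B t)).
  rewrite ge0_integral_setU//; first last.
  - by apply/disj_setPS => x [[_ ?] []].
  - by move=> x _; rewrite lee_fin.
  - exact: (measurable_funTS (mEM t)).
  rewrite leeD2r// -integral_cst//; apply: ge0_le_integral => //.
  - by move=> x _; rewrite lee_fin ltW.
  - exact: (measurable_funTS (mEM t)).
  - by move=> x []; rewrite /B/= lee_fin.
have inv t : a%:E * P (D t) + \int[P]_(x in ~` D t) (M t x)%:E <= 1.
  elim: t => [|t IH].
    rewrite /D big_ord_recr big_ord0 /= set0U; apply: le_trans M1.
    by have := split_le 0%N setT measurableT; rewrite setTI setTD.
  apply: le_trans IH; rewrite {1 2}/D big_ord_recr -/(D t) /=.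
  have -> : D t `|` B t.+1 = D t `|` (~` D t `&` B t.+1).
    by rewrite setUIr setUCr setTI.
  rewrite measureU//; first last.
  - by rewrite setIA setICr set0I.
  - by apply: measurableI => //; exact: measurableC.
  have -> : ~` (D t `|` (~` D t `&` B t.+1)) = ~` D t `\` B t.+1.
    by rewrite setUIr setUCr setTI setCU setDE.
  rewrite ge0_muleDr// -addeA leeD2l//.
  (* The complement of [D t] is known at time $t$, so $M_t$ may be replaced there by $M_{t+1}$
     before [split_le] is applied at time $t+1$. *)
  have FCD : F t (~` D t).
    have := @measurableC _ (g_sigma_algebraType (F t)) (D t).
    by rewrite measurable_g_measurableTypeE//; apply.
  apply: le_trans (MS _ _ FCD).
  by apply: split_le; exact: measurableC.
have PD t : P (D t) <= (a^-1)%:E.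
  rewrite -(@lee_pmul2l _ a%:E)// ?lte_fin// -EFinM divff ?gt_eqF//.
  apply: le_trans (inv t); rewrite leeDl// integral_ge0// => x _.
  by rewrite lee_fin.
rewrite -/B -bigcup_bigsetU_bigcup.
have ndD : {homo D : n m / (n <= m)%N >-> (n <= m)%O}.
  by move=> n m nm; apply/subsetPset; exact: subset_bigsetU.
have cD := nondecreasing_cvg_mu mD (bigcupT_measurable _ mD) ndD (mu := P).
rewrite -(cvg_lim _ cD)//; apply: lime_le; first by apply/cvg_ex; eexists; exact: cD.
by apply: nearW => n /=; exact: PD.
Qed.

End drift_and_ville.

(** * Measurability of the extended logarithm and of finite sums and products *)

Lemma measurable_lne (R : realType) : measurable_fun setT (@lne R).
Proof.
have -> : @lne R = fun x => if x <= 0 then -oo else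
    if x < +oo then (ln (fine x))%:E else +oo.
  apply/funext => -[r||] //=; by rewrite ?lee_fin ?ltry ?leye_eq ?leNye.
have mle : measurable_fun setT (fun x : \bar R => x <= 0).
  apply: (measurable_fun_bool true).
  exact: (emeasurable_fun_infty_c measurableT (@measurable_id _ _ setT)).
have mlt : measurable_fun setT (fun x : \bar R => x < +oo).
  apply: (measurable_fun_bool true).
  exact: (emeasurable_fun_infty_o measurableT (@measurable_id _ _ setT)).
have mln : measurable_fun setT (fun x : \bar R => (ln (fine x))%:E).
  apply/measurable_EFinP; apply: (measurableT_comp (@measurable_ln R)).
  exact: fine_measurable.
have mif := measurable_fun_ifT mlt mln (measurable_cst (+oo : \bar R)).
exact: (measurable_fun_ifT mle (measurable_cst (-oo : \bar R)) mif).
Qed.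

(** The operation is left abstract to cover the product in [wealth], the extended sum in [Vhat] and
    the real sum in the exponent of [M]. *)
Lemma measurable_big_nat d (T : measurableType d) d' (U : measurableType d')
    (idx : U) (op : Monoid.law idx) (h : nat -> T -> U) (m n : nat) :
  (forall f g : T -> U, measurable_fun setT f -> measurable_fun setT g ->
     measurable_fun setT (fun x => op (f x) (g x))) ->
  (forall i, (m <= i < n)%N -> measurable_fun setT (h i)) ->
  measurable_fun setT (fun x => \big[op/idx]_(m <= i < n) h i x).
Proof.
move=> mop; elim: n => [|n IH] mh.
  rewrite (_ : (fun x => _) = cst idx); first exact: measurable_cst.
  by apply/funext => x; rewrite big_geq.
case: (leqP m n) => mn.
  rewrite (_ : (fun x => _) = fun x => op (\big[op/idx]_(m <= i < n) h i x) (h n x)).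
    apply: mop; last by apply: mh; rewrite mn leqnn.
    by apply: IH => i /andP[mi ni]; apply: mh; rewrite mi ltnW.
  by apply/funext => x; rewrite big_nat_recr.
rewrite (_ : (fun x => _) = cst idx); first exact: measurable_cst.
by apply/funext => x; rewrite big_geq.
Qed.

(** * First passage times *)

Section first_time.
Context (T : Type) (R : realType).
Implicit Types Q : nat -> T -> Prop.

Lemma first_time_leP Q (t : nat) x :
  first_time R Q x <= t%:R%:E <-> exists s, [/\ (0 < s)%N, (s <= t)%N & Q s x].
Proof.
split=> [h|[s [s0 st Qs]]].
  (* A strict bound on the infimum yields an actual index $s<t+1$, that is $s\le t$. *)
  have : first_time R Q x < t.+1%:R%:E.
    by rewrite (le_lt_trans h)// lte_fin ltr_nat.
  move=> /ereal_inf_lt[_ [s [s0 Qs] <-]]; rewrite lte_fin ltr_nat ltnS => st.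
  by exists s.
apply: ge_ereal_inf; exists s%:R%:E; first by exists s.
by rewrite lee_fin ler_nat.
Qed.

(** Comparing two infima becomes a countable conjunction over $t$, which gives measurability of the
    event and lets the comparison be checked one time at a time. *)
Lemma first_time_le_first_time Q1 Q2 x :
  first_time R Q1 x <= first_time R Q2 x <->
  forall t : nat, ~ ((0 < t)%N /\ Q2 t x) \/ first_time R Q1 x <= t%:R%:E.
Proof.
split=> [h t|h].
  have [Q2t|] := pselect ((0 < t)%N /\ Q2 t x); last by left.
  by right; apply: (le_trans h); apply: ereal_inf_lbound; exists t.
by apply: le_ereal_inf_tmp => _ [t Q2t <-]; case: (h t).
Qed.

End first_time.

Section measurable_first_time.
Context d (T : measurableType d) (R : realType).
Implicit Types Q : nat -> T -> Prop.

Lemma measurable_first_time_le Q (t : nat) :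
  (forall s, (0 < s)%N -> (s <= t)%N -> measurable [set x | Q s x]) ->
  measurable [set x | first_time R Q x <= t%:R%:E].
Proof.
move=> mQ.
rewrite (_ : [set x | _] =
    \bigcup_(s in [set s : nat | (0 < s)%N && (s <= t)%N]) [set x | Q s x]).
  by apply: bigcup_measurable => s /= /andP[s0 st]; exact: mQ.
apply/seteqP; split => x /=.
  by move=> /first_time_leP[s [s0 st Qs]]; exists s => //=; rewrite s0.
by move=> [s /= /andP[s0 st] Qs]; apply/first_time_leP; exists s.
Qed.

Lemma measurable_first_time_le_first_time Q1 Q2 :
  (forall s, (0 < s)%N -> measurable [set x | Q1 s x]) ->
  (forall s, (0 < s)%N -> measurable [set x | Q2 s x]) ->
  measurable [set x | first_time R Q1 x <= first_time R Q2 x].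
Proof.
move=> mQ1 mQ2.
rewrite (_ : [set x | _] = \bigcap_(t : nat) (~` [set x | (0 < t)%N /\ Q2 t x] `|`
    [set x | first_time R Q1 x <= t%:R%:E])).
  apply: bigcapT_measurable => t; apply: measurableU.
    apply: measurableC; case: t => [|t].
      by rewrite (_ : [set x | _] = set0)//; apply/seteqP; split => // x [].
    rewrite (_ : [set x | _] = [set x | Q2 t.+1 x]); first exact: mQ2.
    by apply/seteqP; split => // x [].
  by apply: measurable_first_time_le => s s0 _; exact: mQ1.
apply/seteqP; split => x /=.
  by move=> /first_time_le_first_time h t _; exact: h.
by move=> h; apply/first_time_le_first_time => t; exact: h.
Qed.

End measurable_first_time.

(** * Wealth and variation at a sample point where every log-increment is finite *)

Section pathwise.
Context (T : Type) (R : realType) (E : nat -> T -> \bar R) (c l : nat -> T -> R) (x : T).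
Hypothesis El : forall n, (0 < n)%N -> log_incr E n x = (l n x)%:E.

Lemma wealth_expR t :
  wealth E t x = (expR (\sum_(1 <= n < t.+1) l n x))%:E.
Proof.
rewrite /wealth; elim: t => [|t IH]; first by rewrite !big_geq// expR0.
rewrite big_nat_recr//= IH [in RHS]big_nat_recr//= expRD EFinM; congr (_ * _).
(* A finite logarithm excludes the values $0$ and $+\infty$ of [E], where [lne] has no exponential
   inverse in the reals. *)
have := El (ltn0Sn t); rewrite /log_incr; case: (E t.+1 x) => [r||]//=.
by case: ifPn => //; rewrite -ltNge => r0 [<-]; rewrite lnK.
Qed.

Lemma Vhat_EFin t :
  Vhat E c t x = (\sum_(1 <= n < t.+1) (c n x - l n x) ^+ 2)%R%:E.
Proof.
rewrite /Vhat -sumEFin; apply: eq_big_nat => n /andP[n0 _].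
by rewrite El// -EFinB EFin_expe.
Qed.

End pathwise.

(** * The exponential supermartingale and the two conclusions *)

Section log_wealth.
Context (d : measure_display) (T : measurableType d) (R : realType).
Context (P0 P1 : probability T R) (F : nat -> set (set T)).
Hypothesis hF : filtration F.
Context (E : nat -> T -> \bar R).
Hypothesis hE : betting_sequence P0 F E.
Context (c : nat -> T -> R).
Hypothesis hc : drift_certificate P1 F E c.
Context (rbar : R).
Hypothesis hrbar : (0 < rbar)%R.
Hypothesis hL : forall n, (0 < n)%N ->
     {ae P1, forall x, log_incr E n x <= (c n x + rbar)%:E}.
Context (lambda : R).
Hypothesis hlambda : (0 < lambda < 1)%R.
Context (C : nat -> R).
Hypothesis hC0 : C 0%N = 0%R.
Hypothesis hC : forall t, (0 < t)%N ->
     {ae P1, forall x, (C t <= \sum_(1 <= n < t.+1) c n x)%R}.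
Context (delta : R).
Hypothesis hdelta : (0 < delta < 1)%R.

(** [fine] sends infinite log-increments to $0$, which keeps [M] real, positive and adapted at every
    sample point; by [log_incr_EFin] only a [P1]-null set is affected. *)
Let l n x : R := fine (log_incr E n x).
Let xi n x : R := ((c n x - l n x) / rbar)%R.
Let incr n x : R := (lambda * xi n x - psiE lambda * xi n x ^+ 2)%R.
Let M t x : R := expR (\sum_(1 <= n < t.+1) incr n x).

Let sF n : sigma_algebra setT (F n).
Proof. by case: hF. Qed.
Let Fm n : F n `<=` measurable.
Proof. by case: hF. Qed.
Let Fmono m n : (m <= n)%N -> F m `<=` F n.
Proof. by case: hF => _ _; apply. Qed.

Lemma measurable_wrt_E n t : (0 < n <= t)%N -> measurable_wrt (F t) (E n).
Proof.
case: n => // n /= nt; have [_ mE _] := hE n.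
exact: measurable_wrtS (Fmono nt) mE.
Qed.

Lemma measurable_wrt_log_incr n t : (0 < n <= t)%N -> measurable_wrt (F t) (log_incr E n).
Proof. by move=> nt; apply: (measurableT_comp (@measurable_lne R)); exact: measurable_wrt_E. Qed.

Lemma measurable_wrt_c n t : (0 < n <= t)%N -> measurable_wrt (F t) (c n).
Proof.
case: n => // n /= nt; have [mc _] := hc n.
exact: measurable_wrtS (Fmono (ltnW nt)) mc.
Qed.

Lemma measurable_wrt_wealth t : measurable_wrt (F t) (wealth E t).
Proof.
apply: (@measurable_big_nat _ (g_sigma_algebraType (F t))).
  by move=> f g mf mg; exact: emeasurable_funM.
by move=> i it; exact: measurable_wrt_E.
Qed.

Lemma measurable_wrt_Vhat t : measurable_wrt (F t) (Vhat E c t).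
Proof.
apply: (@measurable_big_nat _ (g_sigma_algebraType (F t))).
  by move=> f g mf mg; exact: emeasurable_funD.
move=> i it.
have mcL : measurable_wrt (F t) (fun x => (c i x)%:E - log_incr E i x).
  apply: emeasurable_funB; last exact: measurable_wrt_log_incr.
  by apply/measurable_EFinP; exact: measurable_wrt_c.
exact: emeasurable_funM.
Qed.

Let measurable_wrt_incr n t : (0 < n <= t)%N -> measurable_wrt (F t) (incr n).
Proof.
move=> nt.
have ml : measurable_wrt (F t) (l n).
  apply: (measurableT_comp (fine_measurable measurableT)).
  exact: measurable_wrt_log_incr.
have mxi : measurable_wrt (F t) (xi n).
  apply: measurable_funM => //; apply: measurable_funB => //.
  exact: measurable_wrt_c.
apply: measurable_funB; apply: measurable_funM => //.
exact: measurable_funX.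
Qed.

Let measurable_wrt_M t : measurable_wrt (F t) (M t).
Proof.
apply: (measurableT_comp (@measurable_expR R)).
apply: (@measurable_big_nat _ (g_sigma_algebraType (F t))).
  by move=> f g mf mg; exact: measurable_funD.
by move=> i it; exact: measurable_wrt_incr.
Qed.

(** The drift certificate excludes $-\infty$ through [condexp_gtNy], and the increment bound
    excludes $+\infty$. *)
Lemma log_incr_EFin : {ae P1, forall x, forall n, (0 < n)%N ->
  log_incr E n x = (l n x)%:E /\ (l n x <= c n x + rbar)%R}.
Proof.
apply: ae_foralln => -[|n]; first exact: aeW.
have [mc [Y XY cY]] := hc n.
have mX : measurable_fun setT (log_incr E n.+1).
  apply: (measurable_wrtW (Fm (n := n.+1))).
  by apply: measurable_wrt_log_incr; rewrite ltn0Sn leqnn.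
have Lgt := condexp_gtNy (sF n) (Fm (n := n)) mX XY cY.
have Lle := hL (ltn0Sn n).
near=> x.
have h1 : -oo < log_incr E n.+1 x by near: x.
have h2 : log_incr E n.+1 x <= (c n.+1 x + rbar)%:E by near: x.
move=> _; rewrite /l; case: (log_incr E n.+1 x) h1 h2 => [r||]//= _.
Unshelve. all: by end_near. Qed.

(* Fan's inequality, integrated against the drift certificate. *)
Let expR_incr_le n A : F n A ->
  \int[P1]_(x in A) (expR (incr n.+1 x))%:E <= P1 A.
Proof.
have [mc [Y XY cY]] := hc n.
have n1 : (0 < n.+1 <= n.+1)%N by rewrite ltn0Sn leqnn.
have /andP[l0 l1] := hlambda.
have mX := measurable_wrtW (Fm (n := n.+1)) (measurable_wrt_log_incr n1).
have mU : measurable_fun setT (fun x => expR (incr n.+1 x)).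
  apply: (measurableT_comp (@measurable_expR R)).
  exact: (measurable_wrtW (Fm (n := n.+1)) (measurable_wrt_incr n1)).
(* The scale comes from $\lambda\xi_n=(\lambda/\bar r)(c_n-L_n)$. *)
apply: (condexp_drift_le (sF n) (Fm (n := n)) (a := lambda / rbar)%R _ mX XY mc cY mU).
- by rewrite divr_ge0// ltW.
- by move=> x; exact: expR_ge0.
apply: filterS log_incr_EFin => x /(_ n.+1 (ltn0Sn n))[LE Lle].
rewrite !funeposE !funenegE LE /= -!EFin_max -?EFinD -?EFinM -?EFinD lee_fin.
have xi1 : (-1 <= xi n.+1 x)%R.
  by rewrite /xi ler_pdivlMr// mulN1r; lra.
have lam : (0 <= lambda < 1)%R by rewrite ltW.
have := expR_psiE_le lam xi1; rewrite -/(incr n.+1 x) => h.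
have xiE : (lambda * xi n.+1 x = lambda / rbar * (c n.+1 x - l n.+1 x))%R.
  by rewrite /xi mulrA mulrAC.
(* Writing $r=r^+-r^-$ for both $c_n$ and $L_n$ brings Fan's inequality to the sign-separated form
   required by [condexp_drift_le]. *)
have maxB (r : R) : (Num.max r 0 - Num.max (- r) 0 = r)%R.
  by rewrite /Num.max; case: (ltP r 0%R) => ?; case: (ltP (- r)%R 0%R) => ?; lra.
rewrite xiE -{1}(maxB (c n.+1 x)) -{1}(maxB (l n.+1 x)) in h.
apply: (le_trans (lerD h (lexx _))).
by rewrite le_eqVlt; apply/orP; left; apply/eqP; ring.
Qed.

Let M_supermartingale n A : F n A ->
  \int[P1]_(x in A) (M n.+1 x)%:E <= \int[P1]_(x in A) (M n x)%:E.
Proof.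
move=> FA.
have n1 : (0 < n.+1 <= n.+1)%N by rewrite ltn0Sn leqnn.
rewrite (eq_integral (fun x => (M n x)%:E * (expR (incr n.+1 x))%:E)); last first.
  by move=> x _; rewrite /M big_nat_recr//= expRD EFinM.
apply: (@integral_mul_le _ _ _ P1 (F n) (EFin \o M n) (fun x => expR (incr n.+1 x)) A (sF n) (Fm (n := n))) => //.
- by apply/measurable_EFinP; exact: measurable_wrt_M.
- by move=> x /=; rewrite lee_fin expR_ge0.
- apply: (measurableT_comp (@measurable_expR R)).
  exact: (measurable_wrtW (Fm (n := n.+1)) (measurable_wrt_incr n1)).
- by move=> B; exact: expR_incr_le.
Qed.

(** A single exceptional event for all times, so that [delta] is paid only once and both conclusions
    hold off the same set. *)
Let B := \bigcup_t [set x | (delta^-1 <= M t x)%R].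

Let mB : measurable B.
Proof.
apply: bigcupT_measurable => t; rewrite -[X in measurable X]setTI.
apply: (@emeasurable_fun_c_infty _ _ _ _ (EFin \o M t) measurableT _ (delta^-1)%:E).
by apply/measurable_EFinP; exact: (measurable_wrtW (Fm (n := t))).
Qed.

Let PB : (1 - delta)%:E <= P1 (~` B).
Proof.
have /andP[d0 d1] := hdelta.
rewrite probability_setC// EFinB leeB// -[delta]invrK.
apply: (ville hF) => //.
- by rewrite invr_gt0.
- by move=> n x; exact: expR_ge0.
- rewrite (eq_integral (cst 1)); last by move=> x _; rewrite /M big_geq// expR0.
  by rewrite integral_cst// mul1e probability_le1.
Qed.

(** The common source of both conclusions: $\log M_t<\log(1/\delta)$ multiplied by $\bar r/\lambda$.
    The real witnesses for $\log W_t$ and $\widehat V_t$ reduce what follows to real arithmetic. *)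
Lemma log_wealth_gt_ae : {ae P1, forall x, (~` B) x -> forall t, exists s v : R,
  [/\ wealth E t x = (expR s)%:E, Vhat E c t x = v%:E &
    (C t - rbar / lambda * ln delta^-1 - psiE lambda / (lambda * rbar) * v < s)%R]}.
Proof.
have /andP[l0 l1] := hlambda; have /andP[d0 d1] := hdelta.
have hC' : {ae P1, forall x, forall t, (C t <= \sum_(1 <= n < t.+1) c n x)%R}.
  apply: ae_foralln => -[|t]; last exact: hC.
  by apply: aeW => x; rewrite hC0 big_geq.
near=> x => nBx t.
have h1 : forall n, (0 < n)%N ->
  log_incr E n x = (l n x)%:E /\ (l n x <= c n x + rbar)%R.
  by near: x; exact: log_incr_EFin.
have h2 : forall t, (C t <= \sum_(1 <= n < t.+1) c n x)%R by near: x.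
have El n : (0 < n)%N -> log_incr E n x = (l n x)%:E by move=> /h1[].
exists (\sum_(1 <= n < t.+1) l n x)%R.
exists (\sum_(1 <= n < t.+1) (c n x - l n x) ^+ 2)%R; split.
- exact: wealth_expR.
- exact: Vhat_EFin.
have : (M t x < delta^-1)%R.
  by rewrite ltNge; apply/negP => Mt; apply: nBx; exists t.
rewrite -[ltRHS]lnK ?posrE ?invr_gt0// ltr_expR.
have Ct := h2 t.
have -> : (\sum_(1 <= n < t.+1) incr n x = lambda / rbar *
    (\sum_(1 <= n < t.+1) c n x - \sum_(1 <= n < t.+1) l n x)
    - psiE lambda / rbar ^+ 2 * \sum_(1 <= n < t.+1) (c n x - l n x) ^+ 2)%R.
  rewrite -sumrB !mulr_sumr -sumrB; apply: eq_bigr => n _.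
  by rewrite /incr /xi expr_div_n; congr (_ - _)%R; rewrite mulrA mulrAC.
move: Ct; set SC := (\sum_(1 <= n < t.+1) c n x)%R.
set SL := (\sum_(1 <= n < t.+1) l n x)%R; set V := (\sum_(1 <= n < t.+1) _ ^+ 2)%R.
set L := ln delta^-1; set psi := psiE lambda => Ct h.
have rl : (0 < rbar / lambda)%R by rewrite divr_gt0.
have : (rbar / lambda * (lambda / rbar * (SC - SL) - psi / rbar ^+ 2 * V) <
  rbar / lambda * L)%R by rewrite ltr_pM2l.
have -> : (rbar / lambda * (lambda / rbar * (SC - SL) - psi / rbar ^+ 2 * V) =
  SC - SL - psi / (lambda * rbar) * V)%R.
  by field; rewrite !gt_eqF.
by move: (rbar / lambda * L)%R (psi / _ * V)%R => u w; lra.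
Unshelve. all: by end_near. Qed.

Lemma prob_log_wealth_gt : prob_at_least P1 (1 - delta)
    [set x | forall t : nat,
       lne (wealth E t x) >
         (C t)%:E - (rbar / lambda * ln delta^-1)%:E
           - (psiE lambda / (lambda * rbar))%:E * Vhat E c t x /\
       (C t)%:E - (rbar / lambda * ln delta^-1)%:E
           - (psiE lambda / (lambda * rbar))%:E * Vhat E c t x >=
         (C t)%:E - (rbar / lambda * ln delta^-1)%:E
           - (lambda / (2 * (1 - lambda) * rbar))%:E * Vhat E c t x].
Proof.
have /andP[l0 l1] := hlambda.
set A := [set x | _].
have mA : measurable A.
  rewrite (_ : A = \bigcap_(t : nat) ([set x | (C t)%:E - (rbar / lambda * ln delta^-1)%:E
           - (psiE lambda / (lambda * rbar))%:E * Vhat E c t x < lne (wealth E t x)]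
      `&` [set x | (C t)%:E - (rbar / lambda * ln delta^-1)%:E
           - (lambda / (2 * (1 - lambda) * rbar))%:E * Vhat E c t x <=
         (C t)%:E - (rbar / lambda * ln delta^-1)%:E
           - (psiE lambda / (lambda * rbar))%:E * Vhat E c t x])); last first.
    by apply/seteqP; split => [x Ax t _|x Ax t]; [exact: Ax|have := Ax t I].
  apply: bigcapT_measurable => t.
  have mV := measurable_wrtW (Fm (n := t)) (@measurable_wrt_Vhat t).
  have mW : measurable_fun setT (fun x => lne (wealth E t x)).
    apply: (measurableT_comp (@measurable_lne R)).
    exact: (measurable_wrtW (Fm (n := t)) (@measurable_wrt_wealth t)).
  have mbound (k : R) : measurable_fun setT (fun x =>
      (C t)%:E - (rbar / lambda * ln delta^-1)%:E - k%:E * Vhat E c t x).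
    by apply: emeasurable_funB => //; exact: measurable_funeM.
  rewrite -[X in measurable (X `&` _)]setTI -[X in measurable (_ `&` X)]setTI.
  by apply: measurableI; [exact: measurable_lte|exact: measurable_lee].
split=> //; apply: (le_trans PB); apply: le_measure_ae => //.
  exact: measurableC.
apply: filterS log_wealth_gt_ae => x + nBx t => /(_ nBx t)[s [v [-> VE sgt]]].
split; first by rewrite VE lne_EFin ?expR_gt0// expRK -EFinM -!EFinB lte_fin.
rewrite leeD2l// leeN2 lee_wpmul2r//.
  by apply: sume_ge0 => n _; rewrite expe2 sqre_ge0.
(* With the common factor $1/(\lambda\bar r)$ exposed, the comparison of coefficients is exactly
   [psiE_le]. *)
rewrite lee_fin (_ : lambda / (2 * (1 - lambda) * rbar) =
  lambda ^+ 2 / (2 * (1 - lambda)) / (lambda * rbar))%R; last first.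
  by field; rewrite !gt_eqF//; lra.
rewrite ler_pM2r ?invr_gt0 ?mulr_gt0//; apply: psiE_le.
by rewrite ltW.
Qed.

Lemma measurable_wrt_That_event (alpha : R) s t : (s <= t)%N ->
  F t [set x | (lambda * (C s - ln alpha^-1) / rbar)%:E >=
    (ln delta^-1)%:E + (psiE lambda / rbar ^+ 2)%:E * Vhat E c s x].
Proof.
move=> st; apply: (Fmono st); apply: g_measurable => //; rewrite -[X in measurable X]setTI.
apply: (@emeasurable_fun_infty_c _ (g_sigma_algebraType (F s))) => //.
apply: emeasurable_funD => //; apply: measurable_funeM.
exact: measurable_wrt_Vhat.
Qed.

Lemma stopping_time_That (alpha : R) :
  stopping_time F (That E c C rbar lambda delta alpha).
Proof.
move=> t; apply: g_measurable => //.
apply: (@measurable_first_time_le _ (g_sigma_algebraType (F t))) => s s0 st.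
by rewrite measurable_g_measurableTypeE//; exact: measurable_wrt_That_event.
Qed.

(** Multiplied by $\bar r/\lambda$, the condition defining [That] says that the lower bound on $\log
    W_t$ is at least $\log(1/\alpha)$. As that lower bound is strict, $W_t>1/\alpha$, hence
    $\tau_\alpha\le t$ at every such $t$; if there is none, [That] is $+\infty$. *)
Lemma prob_tau_le_That (alpha : R) : (0 < alpha < 1)%R ->
  prob_at_least P1 (1 - delta)
    [set x | tau E alpha x <= That E c C rbar lambda delta alpha x].
Proof.
move=> /andP[a0 a1]; have /andP[l0 l1] := hlambda.
have mA : measurable [set x | tau E alpha x <= That E c C rbar lambda delta alpha x].
  apply: measurable_first_time_le_first_time => s s0.
    rewrite -[X in measurable X]setTI; apply: emeasurable_fun_o_infty => //.
    exact: (measurable_wrtW (Fm (n := s)) (@measurable_wrt_wealth s)).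
  exact: (Fm (measurable_wrt_That_event _ (leqnn s))).
split=> //; apply: (le_trans PB); apply: le_measure_ae => //.
  exact: measurableC.
apply: filterS log_wealth_gt_ae => x + nBx => /(_ nBx) good.
apply/first_time_le_first_time => t.
set Q := (X in ~ X \/ _); have [[t0 Qt]|] := pselect Q; last by left.
right; apply/first_time_leP; exists t; split => //.
have [s [v [-> VE sgt]]] := good t.
move: Qt; rewrite VE -EFinM -EFinD lee_fin lte_fin => Qt.
rewrite -[ltLHS]lnK ?posrE ?invr_gt0// ltr_expR.
apply: le_lt_trans sgt.
have : (rbar / lambda * (ln delta^-1 + psiE lambda / rbar ^+ 2 * v) <=
   rbar / lambda * (lambda * (C t - ln alpha^-1) / rbar))%R.
  by rewrite ler_pM2l// divr_gt0.
have -> : (rbar / lambda * (lambda * (C t - ln alpha^-1) / rbar) = C t - ln alpha^-1)%R.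
  by field; rewrite !gt_eqF.
have -> : (rbar / lambda * (ln delta^-1 + psiE lambda / rbar ^+ 2 * v) =
  rbar / lambda * ln delta^-1 + psiE lambda / (lambda * rbar) * v)%R.
  by field; rewrite !gt_eqF.
by move: (rbar / lambda * _)%R (psiE lambda / _ * v)%R => u w; lra.
Qed.

End log_wealth.

Unset Implicit Arguments.
Set Strict Implicit.

Theorem theorem5p2 (d : measure_display) (T : measurableType d) (R : realType)
  (P0 P1 : probability T R) (F : nat -> set (set T))
  (hF : filtration F) (hF0 : F 0%N = [set set0; setT])
  (hdom : forall t, dominated_on (F t) P1 P0)
  (E : nat -> T -> \bar R) (hE : betting_sequence P0 F E)
  (c : nat -> T -> R) (hc : drift_certificate P1 F E c)
  (C : nat -> R) (hC0 : C 0%N = 0%R)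
  (hC : forall t, (0 < t)%N ->
     {ae P1, forall x, (C t <= \sum_(1 <= n < t.+1) c n x)%R})
  (rbar : R) (hrbar : (0 < rbar)%R)
  (hL : forall n, (0 < n)%N ->
     {ae P1, forall x, log_incr E n x <= (c n x + rbar)%:E})
  (lambda : R) (hlambda : (0 < lambda < 1)%R)
  (delta : R) (hdelta : (0 < delta < 1)%R) :
  prob_at_least P1 (1 - delta)
    [set x | forall t : nat,
       lne (wealth E t x) >
         (C t)%:E - (rbar / lambda * ln delta^-1)%:E
           - (psiE lambda / (lambda * rbar))%:E * Vhat E c t x /\
       (C t)%:E - (rbar / lambda * ln delta^-1)%:E
           - (psiE lambda / (lambda * rbar))%:E * Vhat E c t x >=
         (C t)%:E - (rbar / lambda * ln delta^-1)%:E
           - (lambda / (2 * (1 - lambda) * rbar))%:E * Vhat E c t x]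
  /\
  forall alpha : R, (0 < alpha < 1)%R ->
    prob_at_least P1 (1 - delta)
      [set x | tau E alpha x <= That E c C rbar lambda delta alpha x] /\
    stopping_time F (That E c C rbar lambda delta alpha).
Proof.
split; first exact: (prob_log_wealth_gt hF hE hc hrbar hL hlambda hC0 hC hdelta).
move=> alpha halpha; split.
  exact: (prob_tau_le_That hF hE hc hrbar hL hlambda hC0 hC hdelta halpha).
exact: (stopping_time_That hF hE hc rbar lambda C delta alpha).
Qed.
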